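(* Let $\mathcal X$, $\mathcal C$, $h$, $D_h$ be as in the context and let $f:\mathcal X\to\mathbb R$ be $C^1$ on $\mathcal C$. Let $x_0\in\mathcal C$ and let $(x_k)_{k\ge0}$ be such that each $x_{k+1}\in\mathcal C$ is a global minimizer over $\mathcal X$ of $x\mapsto f(x)+\frac1{\eta_k}D_h(x,x_k)$, where $0<\underline\eta\le\eta_k\le\overline\eta<\infty$ for all $k$, with fixed constants $\underline\eta,\overline\eta$. Assume that all iterates lie in a compact convex set $\mathcal K\subset\mathcal C$ on which $\sigma_hI\preceq\nabla^2h(x)\preceq L_hI$ for constants $0<\sigma_h\le L_h<\infty$, that $f$ is bounded below on $\mathcal K$, and that $f$ has the Kurdyka--Łojasiewicz property on $\mathcal K$. Then the sequence has finite length, $$\sum_{k=0}^\infty\|x_{k+1}-x_k\|<\infty,$$ and converges to a critical point $x^\star\in\mathcal K$ of $f$ (that is, $\nabla f(x^\star)=0$). If the KL inequality at $x^\star$ holds with exponent $\theta\in[0,1)$, then $s_k:=f(x_k)-f(x^\star)$ satisfies: - if $\theta=0$: finite termination; - if $0<\theta\le\tfrac12$: linear convergence, i.e. there is $q\in(0,1)$ with $s_{k+1}\le q\,s_k$ for all sufficiently large $k$; - if $\tfrac12<\theta<1$: $s_k=O\bigl(k^{-1/(2\theta-1)}\bigr)$.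
   Context: $\mathcal X$ is a nonempty closed convex set in a finite-dimensional Euclidean space and $\mathcal C=\operatorname{ri}(\mathcal X)$ is its relative interior. All derivatives (gradients, Hessians, critical points, and the identity $I$ in Hessian bounds) are taken along directions of the affine hull $\operatorname{aff}(\mathcal X)$: for $\varphi$ differentiable on $\mathcal C$, $\nabla\varphi(x)$ is the vector in the direction space of $\operatorname{aff}(\mathcal X)$ representing the derivative for the Euclidean inner product. $h:\mathcal C\to\mathbb R$ is a $C^2$ Legendre function (strictly convex, with $\|\nabla h(x_j)\|\to\infty$ whenever $x_j\in\mathcal C$ tends to a point of $\mathcal X\setminus\mathcal C$), extended continuously to boundary points of $\mathcal X$ where needed. For $x\in\mathcal X$, $y\in\mathcal C$, $D_h(x,y)=h(x)-h(y)-\langle\nabla h(y),x-y\rangle$. Kurdyka--Łojasiewicz (KL) property: $f$ has the KL property at $\bar x$ if there are $\varepsilon>0$, a neighborhood $U$ of $\bar x$, and a continuous concave $\varphi:[0,\varepsilon)\to[0,\infty)$, $C^1$ on $(0,\varepsilon)$, with $\varphi(0)=0$, $\varphi'>0$, such that $\varphi'(f(x)-f(\bar x))\,\|\nabla f(x)\|\ge1$ for all $x\in U$ with $f(\bar x)<f(x)<f(\bar x)+\varepsilon$; it has the KL property on $\mathcal K$ if this holds at every point of $\mathcal K$. The KL inequality at $\bar x$ holds with exponent $\theta\in[0,1)$ if one can take $\varphi(s)=c\,s^{1-\theta}$ for some $c>0$. *)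

(* Defs.v *)
From HB Require Import structures.
From mathcomp Require Import all_boot all_order all_algebra.
From mathcomp Require Import all_classical all_reals all_analysis.

Set Implicit Arguments.
Unset Strict Implicit.
Unset Printing Implicit Defensive.

Import Order.TTheory GRing.Theory Num.Theory.
Import numFieldTopology.Exports numFieldNormedType.Exports.

Local Open Scope classical_set_scope.
Local Open Scope ring_scope.

(* The norm [`|u|] that the library puts on 'rV[R]_n is the sup norm; it has
   the same topology and the same little-o's as the Euclidean norm [enorm]. *)
Definition dot {R : realType} {n : nat} (u v : 'rV[R]_n) : R :=
  \sum_(i < n) u 0 i * v 0 i.

Definition enorm {R : realType} {n : nat} (u : 'rV[R]_n) : R :=
  Num.sqrt (dot u u).

Section RelativeCalculus.
Context {R : realType} {n : nat}.
Notation V := 'rV[R]_n.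
Implicit Type X : set V.

Definition aff X : set V :=
  [set y | exists (m : nat) (a : 'I_m -> R) (p : 'I_m -> V),
    [/\ forall i, X (p i), \sum_(i < m) a i = 1
      & y = \sum_(i < m) a i *: p i]].

(* Direction space of [aff X]. *)
Definition dir X : set V :=
  [set v | exists y z, [/\ aff X y, aff X z & v = y - z]].

(* Filter of the neighbourhoods of [x] relative to [aff X]. *)
Definition anbhs X (x : V) : set_system V := within (aff X) (nbhs x).

Definition ri X : set V := [set x | X x /\ anbhs X x X].

(* Functions on [ri X] are represented by total functions on V. At a point x of
   [ri X] the filter [anbhs X x] only sees [ri X], so values outside [ri X] are
   irrelevant. *)
Definition is_rgrad X (g : V -> R) (x d : V) : Prop :=
  let F := anbhs X x in
  dir X d /\ (fun y => g y - g x - dot d (y - x)) =o_F (fun y => y - x).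

(* Equal to 0 where [g] has no gradient. *)
Definition rgrad X (g : V -> R) (x : V) : V := xget 0 (is_rgrad X g x).

Definition C1 X (g : V -> R) : Prop :=
  (forall x, ri X x -> exists d, is_rgrad X g x d) /\
  {within ri X, continuous (rgrad X g)}.

(* Matrices act on row vectors from the right. The Hessian is an operator on
   [dir X]; extending it by 0 on the orthogonal complement makes the
   representing n x n matrix unique. *)
Definition is_rhess X (g : V -> R) (x : V) (H : 'M[R]_n) : Prop :=
  let F := anbhs X x in
  (forall v, (forall w, dir X w -> dot v w = 0) -> v *m H = 0) /\
  (fun y => rgrad X g y - rgrad X g x - (y - x) *m H) =o_F (fun y => y - x).

Definition rhess X (g : V -> R) (x : V) : 'M[R]_n := xget 0 (is_rhess X g x).

Definition C2 X (g : V -> R) : Prop :=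
  [/\ C1 X g,
      forall x, ri X x -> exists H, is_rhess X g x H
    & {within ri X, continuous (rhess X g)}].

(* [lo I <= rhess X g x <= hi I] in the Loewner order on [dir X]. *)
Definition rhess_bounds X (g : V -> R) (x : V) (lo hi : R) : Prop :=
  forall v, dir X v ->
    lo * dot v v <= dot (v *m rhess X g x) v <= hi * dot v v.

Definition strictly_convex_on (A : set V) (g : V -> R) : Prop :=
  forall x y (t : R), A x -> A y -> x != y -> 0 < t < 1 ->
    g (t *: x + (1 - t) *: y) < t * g x + (1 - t) * g y.

Definition legendre X (h : V -> R) : Prop :=
  [/\ C2 X h,
      strictly_convex_on (ri X) h
    & forall (u : nat -> V) (z : V),
        (forall j, ri X (u j)) -> X z -> ~ ri X z -> u @ \oo --> z ->
        enorm (rgrad X h (u j)) @[j --> \oo] --> +oo].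

(* The continuous extension of [h] to [X] may be infinite at boundary points,
   as for [h x = - ln x] on [X = [0, +oo[]. *)
Definition continuous_extension X (h : V -> R) (hX : V -> \bar R) : Prop :=
  (forall x, ri X x -> hX x = (h x)%:E) /\ {within X, continuous hX}.

(* [bregman X h hX x y] is D_h(x, y) for [x] in [X] and [y] in [ri X]. *)
Definition bregman X (h : V -> R) (hX : V -> \bar R) (x y : V) : \bar R :=
  (hX x - (h y)%:E - (dot (rgrad X h y) (x - y))%:E)%E.

Definition global_min (X : set V) (F : V -> \bar R) (x : V) : Prop :=
  X x /\ forall y, X y -> (F x <= F y)%E.

Definition desingularizing (eps : R) (phi : R -> R) : Prop :=
  [/\ {within `[0, eps[, continuous phi},
      convex_function (`[0, eps[)%classic (fun s => - phi s),
      forall s, 0 < s < eps -> derivable phi s 1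
    & {within `]0, eps[, continuous (derive1 phi)}] /\
  [/\ forall s, 0 <= s < eps -> 0 <= phi s,
      phi 0 = 0
    & forall s, 0 < s < eps -> 0 < derive1 phi s].

Definition KL_with X (f : V -> R) (xb : V) (eps : R) (U : set V)
    (phi : R -> R) : Prop :=
  [/\ 0 < eps, nbhs xb U, desingularizing eps phi
    & forall x, ri X x -> U x -> f xb < f x < f xb + eps ->
        1 <= derive1 phi (f x - f xb) * enorm (rgrad X f x)].

Definition KL_at X (f : V -> R) (xb : V) : Prop :=
  exists eps U phi, KL_with X f xb eps U phi.

Definition KL_exponent X (f : V -> R) (xb : V) (theta : R) : Prop :=
  exists c eps U, 0 < c /\
    KL_with X f xb eps U (fun s => c * s `^ (1 - theta)).

End RelativeCalculus.

(* Main.v *)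
Require Import Defs.
From HB Require Import structures.
From mathcomp Require Import all_boot all_order all_algebra.
From mathcomp Require Import all_classical all_reals all_analysis.
From mathcomp Require Import ring lra zify.

Set Implicit Arguments.
Unset Strict Implicit.
Unset Printing Implicit Defensive.

Import Order.TTheory GRing.Theory Num.Theory.
Import numFieldTopology.Exports numFieldNormedType.Exports.
Local Open Scope classical_set_scope.
Local Open Scope ring_scope.

(** Each proximal step yields two estimates for the step length
    [D k = enorm (x k.+1 - x k)]. Comparing the minimizer with the previous
    iterate gives sufficient decrease, [a * D k ^+ 2 <= f (x k) - f (x k.+1)],
    because the lower Hessian bound makes the Bregman distance at least
    [sigma / 2] times the squared Euclidean distance ([bregman_ge_sqr],
    [prox_decrease]). Minimizers lie in the relative interior, so Fermat's rule
    holds there along the affine hull and equates the gradient of [f] at the new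
    iterate with a scaled difference of gradients of [h] ([prox_rgrad]); these
    are Lipschitz on [K] ([rgrad_lipschitz]), hence
    [enorm (rgrad X f (x k.+1)) <= b * D k].

    From there on only numbers matter. The iterates have a cluster point [xs] in
    the compact set [K], the values decrease to [f xs], and the KL inequality at
    this single point suffices. With [r k = f (x k) - f xs], concavity of the
    desingularizing function [phi] turns the two estimates into
    [2 * D k.+1 <= D k + b / a * (phi (r k.+1) - phi (r k.+2))] as long as
    [x k.+1] is in the neighbourhood where KL holds ([KL_step]). This telescopes,
    so once an iterate is close to [xs] with a small remaining budget, the
    sequence can no longer leave the neighbourhood ([KL_trap]): it has finite
    length and converges to [xs]. Gradients tend to 0 along it and are
    continuous, so [xs] is critical.

    With an exponent [theta], the same two estimates and the KL inequality
    combine into [alpha * r k.+1 `^ (2 * theta) <= r k - r k.+1] for large [k],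
    and the three rates are properties of this real recursion ([rate_finite],
    [rate_linear], [rate_sublinear]). *)

(** * Euclidean structure of row vectors *)

Section Dot.
Context {R : realType} {n : nat}.
Implicit Types u v w : 'rV[R]_n.

Lemma dotC u v : dot u v = dot v u.
Proof. by apply: eq_bigr => i _; rewrite mulrC. Qed.

Lemma dotDl u v w : dot (u + v) w = dot u w + dot v w.
Proof. by rewrite -big_split; apply: eq_bigr => i _; rewrite mxE mulrDl. Qed.

Lemma dotZl a u v : dot (a *: u) v = a * dot u v.
Proof. by rewrite mulr_sumr; apply: eq_bigr => i _; rewrite mxE mulrA. Qed.

Lemma dotBl u v w : dot (u - v) w = dot u w - dot v w.
Proof. by rewrite -scaleN1r dotDl dotZl mulN1r. Qed.

Lemma dotZr a u v : dot u (a *: v) = a * dot u v.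
Proof. by rewrite dotC dotZl dotC. Qed.

Lemma dot0r u : dot u 0 = 0.
Proof. by rewrite -(scale0r (0 : 'rV_n)) dotZr mul0r. Qed.

Lemma dot_ge0 u : 0 <= dot u u.
Proof. by apply: sumr_ge0 => i _; rewrite -expr2 sqr_ge0. Qed.

Lemma sqr_enorm u : enorm u ^+ 2 = dot u u.
Proof. by rewrite sqr_sqrtr ?dot_ge0. Qed.

Lemma enorm_ge0 u : 0 <= enorm u.
Proof. exact: sqrtr_ge0. Qed.

Lemma normr_le_enorm u : `|u| <= enorm u.
Proof.
rewrite [leLHS]mx_normrE; apply/bigmax_leP; split; first exact: enorm_ge0.
move=> [i j] _ /=; rewrite ord1 -sqrtr_sqr ler_wsqrtr// /dot (bigD1 j)//= -expr2.
by rewrite lerDl sumr_ge0// => k _; rewrite -expr2 sqr_ge0.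
Qed.

Lemma coord_le_normr (u : 'rV[R]_n) i : `|u 0 i| <= `|u|.
Proof.
rewrite [leRHS]mx_normrE.
exact: (le_bigmax _ (fun k => `|u k.1 k.2|) (0, i)).
Qed.

Lemma enorm_le_normr u : enorm u <= n%:R * `|u|.
Proof.
rewrite -(@ler_pXn2r _ 2)// ?nnegrE ?enorm_ge0 ?mulr_ge0//.
rewrite sqr_enorm exprMn; apply: (@le_trans _ _ (\sum_(i < n) `|u| ^+ 2)).
  apply: ler_sum => i _; rewrite -expr2 -real_normK ?num_real//.
  by rewrite ler_pXn2r ?nnegrE// coord_le_normr.
rewrite sumr_const card_ord -[leLHS]mulr_natl ler_wpM2r ?sqr_ge0//.
by rewrite -natrX ler_nat; case: (n) => // m; rewrite expnS leq_pmulr.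
Qed.

Lemma enorm_eq0 u : enorm u = 0 -> u = 0.
Proof.
move=> u0; apply/eqP; rewrite -normr_eq0 eq_le normr_ge0 andbT.
by rewrite -u0 normr_le_enorm.
Qed.

Lemma normr_dot_le u v : `|dot u v| <= n%:R * `|u| * `|v|.
Proof.
apply: (le_trans (ler_norm_sum _ _ _)).
apply: (@le_trans _ _ (\sum_(i < n) `|u| * `|v|)).
  by apply: ler_sum => i _; rewrite normrM ler_pM// coord_le_normr.
by rewrite sumr_const card_ord -[leLHS]mulr_natl mulrA.
Qed.

Lemma normr_mulmx_le u (H : 'M[R]_n) : `|u *m H| <= n%:R * `|u| * `|H|.
Proof.
rewrite [leLHS]mx_normrE; apply/bigmax_leP; split; first by rewrite !mulr_ge0.
move=> [i j] _ /=; rewrite ord1 mxE; apply: (le_trans (ler_norm_sum _ _ _)).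
apply: (@le_trans _ _ (\sum_(i < n) `|u| * `|H|)).
  apply: ler_sum => k _; rewrite normrM ler_pM// ?coord_le_normr//.
  rewrite [leRHS]mx_normrE.
  exact: (le_bigmax _ (fun l => `|H l.1 l.2|) (k, j)).
by rewrite sumr_const card_ord -[leLHS]mulr_natl mulrA.
Qed.

End Dot.

(** * Affine hull, its directions and its lines *)

Section AffineHull.
Context {R : realType} {n : nat}.
Variable X : set 'rV[R]_n.
Implicit Types y z v w : 'rV[R]_n.

Lemma sub_aff : X `<=` aff X.
Proof.
move=> y Xy; exists 1%N, (fun=> 1), (fun=> y).
by split => //; rewrite big_ord1 ?scale1r.
Qed.

Lemma ri_aff y : ri X y -> aff X y.
Proof. by move=> [] /sub_aff. Qed.

Lemma aff_line (t : R) y z : aff X y -> aff X z -> aff X (t *: y + (1 - t) *: z).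
Proof.
move=> [m1 [a1 [p1 [Xp1 a11 ->]]]] [m2 [a2 [p2 [Xp2 a21 ->]]]].
exists (m1 + m2)%N,
  (fun i : 'I_(m1 + m2) => match fintype.split i with
    | inl j => t * a1 j | inr j => (1 - t) * a2 j end),
  (fun i : 'I_(m1 + m2) => match fintype.split i with
    | inl j => p1 j | inr j => p2 j end).
have splitl (j : 'I_m1) : fintype.split (lshift m2 j) = inl j.
  exact: (unsplitK (inl j)).
have splitr (j : 'I_m2) : fintype.split (rshift m1 j) = inr j.
  exact: (unsplitK (inr j)).
split; first by move=> i; case: fintype.split.
- rewrite big_split_ord/=; under eq_bigr do rewrite splitl.
  under [X in _ + X]eq_bigr do rewrite splitr.
  by rewrite -!mulr_sumr a11 a21; ring.
- rewrite big_split_ord/=; under [X in _ = X + _]eq_bigr do rewrite splitl -scalerA.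
  under [X in _ = _ + X]eq_bigr do rewrite splitr -scalerA.
  by rewrite !scaler_sumr.
Qed.

Lemma affD y v : aff X y -> dir X v -> aff X (y + v).
Proof.
move=> yX [z [w [zX wX ->]]].
(* midpoint of a point of the line (y, z) and a point of the line (y, w) *)
have -> : y + (z - w) = 2^-1 *: (2 *: z + (1 - 2) *: y) +
    (1 - 2^-1) *: ((-2) *: w + (1 - (-2)) *: y).
  by apply/rowP => i; rewrite !mxE; lra.
by do !apply: aff_line.
Qed.

Lemma dirZ (t : R) v : dir X v -> dir X (t *: v).
Proof.
move=> [y [z [yX zX ->]]]; exists (t *: y + (1 - t) *: z), z; split => //.
  exact: aff_line.
by apply/rowP => i; rewrite !mxE; ring.
Qed.

Lemma dirD v w : dir X v -> dir X w -> dir X (v + w).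
Proof.
move=> [y [z [yX zX ->]]] dw; exists (y + w), z; split => //; first exact: affD.
by rewrite addrAC.
Qed.

Lemma dirB v w : dir X v -> dir X w -> dir X (v - w).
Proof. by move=> dv dw; rewrite -scaleN1r; apply: dirD => //; exact: dirZ. Qed.

Lemma dir_sub y z : aff X y -> aff X z -> dir X (y - z).
Proof. by move=> yX zX; exists y, z. Qed.

(** The lines through [y] directed by [dir X] stay in the affine hull, so they
    are tested by the relative neighbourhoods of [y]. *)
Lemma anbhs_line y v (P : set 'rV[R]_n) : aff X y -> dir X v ->
  anbhs X y P -> \forall t \near (0 : R), P (y + t *: v).
Proof.
move=> yX dv yP.
have : (fun t : R => y + t *: v) @ (0 : R) --> y + (0 : R) *: v.
  by apply: cvgD; [exact: cvg_cst|apply: cvgZr_tmp; exact: cvg_id].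
rewrite scale0r addr0 => cv.
have : \forall t \near (0 : R), aff X (y + t *: v) -> P (y + t *: v) := cv _ yP.
apply: filterS => t; apply.
by apply: affD => //; exact: dirZ.
Qed.

(** Reduces relative first-order expansions to one-variable calculus; the base
    point [y] and the time [t0] are separate so that a whole segment can be fed
    to the mean value theorem. *)
Lemma is_derive_line (g ell : 'rV[R]_n -> R) y v (t0 : R) :
  (forall t u, ell (t *: u) = t * ell u) -> aff X (y + t0 *: v) -> dir X v ->
  (forall e : R, 0 < e -> \forall z \near anbhs X (y + t0 *: v),
    `|g z - g (y + t0 *: v) - ell (z - (y + t0 *: v))| <=
      e * `|z - (y + t0 *: v)|) ->
  is_derive t0 1 (fun t => g (y + t *: v)) (ell v).
Proof.
set p := y + t0 *: v; move=> ellZ pX dv gp.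
have quotE : (fun h : R =>
    h^-1 *: (((fun t => g (y + t *: v)) \o shift t0) (h *: 1) - g p)) = (fun h : R => h^-1 *: (g (p + h *: v) - g p)).
  apply/funext => h /=; rewrite -[h%:A]/(h * 1) mulr1 scalerDl.
  by rewrite (addrC (h *: v)) addrA.
suff cv : h^-1 *: (g (p + h *: v) - g p) @[h --> (0 : R)^'] --> ell v.
  apply: DeriveDef; first by apply/cvg_ex; exists (ell v); rewrite quotE.
  by rewrite /derive quotE; exact/cvg_lim.
apply/cvgrPdist_le => e e0.
have [v0|v0] := eqVneq v 0.
  near=> t.
  rewrite v0 scaler0 addr0 subrr scaler0 subr0.
  by have := ellZ 0 0; rewrite scaler0 mul0r => ->; rewrite normr0 ltW.
have e'0 : 0 < e / `|v| by rewrite divr_gt0// normr_gt0.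
have := anbhs_line pX dv (gp _ e'0).
move=> /(@nbhs_dnbhs _ _); apply: filterS2 (nbhs_dnbhs_neq _).
move=> t t0n0 /=.
rewrite [p + _ - p]addrAC subrr add0r ellZ normrZ mulrCA divfK ?normr_eq0// => h.
rewrite distrC.
have -> : t^-1 *: (g (p + t *: v) - g p) - ell v =
    t^-1 * (g (p + t *: v) - g p - t * ell v).
  by rewrite mulrBr mulKf.
by rewrite normrM normfV ler_pdivrMl ?normr_gt0.
Unshelve. all: by end_near. Qed.

(** Relative openness of the relative interior. *)
Lemma ri_anbhs y : ri X y -> anbhs X y (ri X).
Proof.
move=> [_ yX]; have := nbhs_interior yX; apply: filterS => z /= zX zaff.
by split => //; apply: (nbhs_singleton zX).
Qed.

End AffineHull.

(** * Relative gradients and Hessians *)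

Section RelativeGradient.
Context {R : realType} {n : nat}.
Variable X : set 'rV[R]_n.
Implicit Types (g h : 'rV[R]_n -> R) (y z v d : 'rV[R]_n).

Lemma is_rgrad_near g y d : is_rgrad X g y d -> forall e : R, 0 < e ->
  \forall z \near anbhs X y, `|g z - g y - dot d (z - y)| <= e * `|z - y|.
Proof. by move=> [_ /eqoP]. Qed.

Lemma rgradP g y : C1 X g -> ri X y -> is_rgrad X g y (rgrad X g y).
Proof. by move=> [gX _] /gX; exact: xgetPex. Qed.

Lemma rhessP g y : C2 X g -> ri X y -> is_rhess X g y (rhess X g y).
Proof. by move=> [_ gX _] /gX; exact: xgetPex. Qed.

Lemma is_rgrad_continuous g y d : is_rgrad X g y d -> g z @[z --> anbhs X y] --> g y.
Proof.
move=> gd; apply/cvgrPdist_le => e e0.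
pose M := 1 + n%:R * `|d|.
have M0 : 0 < M by rewrite ltr_pwDl// mulr_ge0.
have yM : \forall z \near anbhs X y, `|z - y| <= e / M.
  apply: cvg_within; near=> z; rewrite distrC; near: z.
  by apply: cvgr_dist_le; [exact: cvg_id|exact: divr_gt0].
apply: filterS2 yM (is_rgrad_near gd ltr01) => z zM; rewrite mul1r => gz.
rewrite distrC -[_ - _](subrK (dot d (z - y))).
apply: (le_trans (ler_normD _ _)).
apply: (@le_trans _ _ (M * `|z - y|)); last first.
  by rewrite mulrC -ler_pdivlMr.
by rewrite mulrDl mul1r lerD// normr_dot_le.
Unshelve. all: by end_near. Qed.

(** Relative form of Fermat's rule: the step [- s *: d] stays in [ri X] for
    small [s > 0], and decreases [g] to first order by [s * dot d d]. *)
Lemma rgrad_min_eq0 g y d : ri X y -> is_rgrad X g y d ->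
  (forall z, ri X z -> g y <= g z) -> d = 0.
Proof.
move=> yX gd gmin; have [dX _] := gd.
apply/eqP/negP => /negP d0; have nd : 0 < `|d| by rewrite normr_gt0.
have e0 : 0 < `|d| / 2 by rewrite divr_gt0.
have dNX : dir X (- d) by rewrite -scaleN1r; exact: dirZ.
have H := anbhs_line (ri_aff yX) dNX (ri_anbhs yX).
have H' := anbhs_line (ri_aff yX) dNX (is_rgrad_near gd e0).
have : \forall s \near (0 : R)^'+, False.
  near=> s.
  have s0 : 0 < s by near: s; exact: nbhs_right_gt.
  have sX : ri X (y + s *: - d) by near: s; apply: cvg_within; exact: H.
  have /ler_normlP[_] : `|g (y + s *: - d) - g y - dot d (y + s *: - d - y)| <=
    `|d| / 2 * `|y + s *: - d - y| by near: s; apply: cvg_within; exact: H'.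
  rewrite [y + _ - y]addrAC subrr add0r normrZ normrN gtr0_norm// dotZr.
  rewrite -scaleN1r dotZr.
  have dd : `|d| ^+ 2 <= dot d d.
    rewrite -sqr_enorm lerXn2r ?nnegrE//; first exact: enorm_ge0.
    exact: normr_le_enorm.
  have := gmin _ sX; rewrite scaleN1r => gs gd'.
  have : s * dot d d <= s * (`|d| ^+ 2 / 2) by lra.
  rewrite ler_pM2l// => ?.
  have : 0 < `|d| ^+ 2 by rewrite exprn_gt0.
  by lra.
by move=> /filter_ex [].
Unshelve. all: by end_near. Qed.

Lemma is_derive_rgrad_line g y v u (t : R) : C2 X g -> ri X (y + t *: v) ->
  dir X v ->
  is_derive t 1 (fun s => dot (rgrad X g (y + s *: v)) u)
    (dot (v *m rhess X g (y + t *: v)) u).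
Proof.
move=> gC2 pX dv; set p := y + t *: v; set H := rhess X g p.
apply: (@is_derive_line _ _ X (fun z => dot (rgrad X g z) u)
  (fun w => dot (w *m H) u)) => //.
- by move=> a w; rewrite -scalemxAl dotZl.
- exact: ri_aff.
move=> e e0; pose M := 1 + n%:R * `|u|.
have M0 : 0 < M by rewrite ltr_pwDl// mulr_ge0.
have [_ /eqoP/(_ _ (divr_gt0 e0 M0))] := rhessP gC2 pX.
apply: filterS => z /= gz.
rewrite -!dotBl; apply: (le_trans (normr_dot_le _ _)).
apply: (@le_trans _ _ (M * `|rgrad X g z - rgrad X g p - (z - p) *m H|)).
  by rewrite mulrAC ler_wpM2r// lerDr.
by rewrite -ler_pdivlMl// mulrA (mulrC _ e).
Qed.

Lemma is_derive_fun_line g y v (t : R) : C1 X g -> ri X (y + t *: v) ->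
  dir X v ->
  is_derive t 1 (fun s => g (y + s *: v)) (dot (rgrad X g (y + t *: v)) v).
Proof.
move=> gC1 pX dv; apply: (@is_derive_line _ _ X g) => //.
- by move=> a w; rewrite dotZr.
- exact: ri_aff.
- exact/is_rgrad_near/rgradP.
Qed.

End RelativeGradient.

(** * Integrating the Hessian along segments *)

Section HessianBounds.
Context {R : realType} {n : nat}.
Variables (X K : set 'rV[R]_n) (h : 'rV[R]_n -> R).
Hypotheses (hC2 : C2 X h) (K_compact : compact K) (K_convex : convex_set K).
Hypothesis K_ri : K `<=` ri X.
Implicit Types y z : 'rV[R]_n.

Lemma segment_subK y z (t : R) : K y -> K z -> 0 <= t <= 1 -> K (y + t *: (z - y)).
Proof.
move=> Ky Kz /andP[t0 t1].
have := set_mem (@K_convex z y (Itv01 t0 t1) (mem_set Kz) (mem_set Ky)).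
have -> // : y + t *: (z - y) = t *: z + (1 - t) *: y.
by apply/rowP => i; rewrite !mxE; ring.
Qed.

Lemma dir_subK y z : K y -> K z -> dir X (z - y).
Proof. by move=> /K_ri/ri_aff yX /K_ri/ri_aff zX; exact: dir_sub. Qed.

(** Bounds on the quadratic form of the Hessian control its entries only through
    symmetry; continuity on the compact set [K] bounds them directly. *)
Lemma rhess_bounded : exists2 B, 0 < B & forall z, K z -> `|rhess X h z| <= B.
Proof.
have [_ _ hcont] := hC2.
have := continuous_compact (continuous_subspaceW K_ri hcont) K_compact.
move=> /compact_bounded[M [_ MB]].
exists (`|M| + 1) => [|z Kz]; first by rewrite ltr_wpDl.
apply: MB; last by exists z.
by rewrite (le_lt_trans (ler_norm M))// ltrDl.
Qed.

Lemma MVT_from0 (g dg : R -> R) (s : R) : 0 < s ->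
  (forall t, 0 <= t <= s -> is_derive t 1 g (dg t)) ->
  exists2 t, 0 <= t <= s & g s - g 0 = dg t * s.
Proof.
move=> s0 gd.
have [x xs||t] := @MVT R g dg 0 s s0.
- by apply: gd; move: xs; rewrite in_itv/= => /andP[/ltW-> /ltW->].
- apply: derivable_within_continuous => t; rewrite in_itv/= => ts.
  by have [] := gd t ts.
- rewrite in_itv/= => /andP[/ltW ? /ltW ?]; rewrite subr0 => gE.
  by exists t => //; apply/andP.
Qed.

(** Mean value theorem along the segment, one coordinate of the gradient at a
    time: coordinate [j] is the inner product with [delta_mx 0 j]. *)
Lemma rgrad_lipschitz : exists2 C, 0 < C & forall y z, K y -> K z ->
  `|rgrad X h z - rgrad X h y| <= C * `|z - y|.
Proof.
have [B B0 hB] := rhess_bounded.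
(* the summand 1 keeps the constant positive when [n = 0] *)
exists (1 + n%:R * B) => [|y z Ky Kz]; first by rewrite ltr_pwDl// mulr_ge0// ltW.
rewrite [leLHS]mx_normrE; apply/bigmax_leP; split.
  by rewrite mulr_ge0// addr_ge0// mulr_ge0// ltW.
move=> [i j] _ /=; rewrite ord1.
have dotE w : dot w (delta_mx 0 j) = w 0 j.
  rewrite /dot (bigD1 j)//= big1 ?addr0 => [|k kj]; rewrite mxE ?eqxx ?mulr1//.
  by rewrite (negbTE kj) andbF mulr0.
have [|t t01] := @MVT_from0
  (fun s => dot (rgrad X h (y + s *: (z - y))) (delta_mx 0 j))
  (fun s => dot ((z - y) *m rhess X h (y + s *: (z - y))) (delta_mx 0 j)) 1 ltr01.
  move=> t t01; apply: is_derive_rgrad_line => //; last exact: dir_subK.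
  by apply/K_ri; exact: segment_subK.
rewrite scale1r scale0r addr0 subrKC mulr1 !dotE => E.
rewrite mxE mxE E; apply: (le_trans (coord_le_normr _ _)).
apply: (le_trans (normr_mulmx_le _ _)).
rewrite mulrAC ler_wpM2r//.
apply: (@le_trans _ _ (n%:R * B)); last by rewrite lerDr.
by rewrite ler_wpM2l// hB//; exact: segment_subK.
Qed.

(** Integrating the lower bound on the Hessian twice along the segment from [y]
    to [z]: [psi] is the slope of [h] there, and [theta] is what remains to be
    shown nonnegative at time 1. *)
Lemma bregman_ge_sqr (sigma : R) :
  (forall z, K z -> forall v, dir X v ->
    sigma * dot v v <= dot (v *m rhess X h z) v) ->
  forall y z, K y -> K z ->
  sigma / 2 * dot (z - y) (z - y) <= h z - h y - dot (rgrad X h y) (z - y).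
Proof.
move=> hess y z Ky Kz; set v := z - y.
have dv : dir X v by exact: dir_subK.
have Kt t : 0 <= t <= 1 -> K (y + t *: v) by exact: segment_subK.
have [hC1 _ _] := hC2.
pose psi t := dot (rgrad X h (y + t *: v)) v.
have psi_ge t : 0 <= t <= 1 -> t * (sigma * dot v v) <= psi t - psi 0.
  move=> /andP[t0 t1]; have [->|tn0] := eqVneq t 0; first by rewrite mul0r subrr.
  have [||r /andP[r0 rt] ->] := @MVT_from0 psi
    (fun s => dot (v *m rhess X h (y + s *: v)) v) t.
  - by rewrite lt_neqAle eq_sym tn0.
  - move=> s /andP[s0 st]; apply: is_derive_rgrad_line => //.
    by apply/K_ri/Kt; rewrite s0 (le_trans st).
  rewrite mulrC ler_wpM2r//.
  have Kr : K (y + r *: v) by apply: Kt; rewrite r0 (le_trans rt).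
  exact: hess.
pose c := sigma * dot v v.
pose theta t := h (y + t *: v) - (t * psi 0 + t ^+ 2 * (c / 2)).
have [|t t01] := @MVT_from0 theta (fun t => psi t - (psi 0 + t * c)) 1 ltr01.
  move=> t t01.
  have dh : is_derive t 1 (fun s => h (y + s *: v)) (psi t).
    by apply: is_derive_fun_line => //; exact/K_ri/Kt.
  apply: is_derive_eq.
  by rewrite /GRing.scale/=; field.
rewrite /theta mulr1 scale1r scale0r addr0 !mul0r expr0n/= mul0r addr0 subr0.
rewrite {1}/v subrKC expr1n !mul1r => E.
have := psi_ge _ t01; rewrite -/c => ?.
have -> : dot (rgrad X h y) v = psi 0 by rewrite /psi scale0r addr0.
by rewrite -mulrA (mulrC 2^-1) mulrA -/c; lra.
Qed.

End HessianBounds.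

(** * Sequences driven by a Kurdyka-Lojasiewicz inequality *)

(** The chord of a concave function from [s] towards [t] has slopes that increase
    as it shrinks to [s]; in the limit they reach the derivative. *)
Lemma concave_tangent (R : realType) (eps : R) (phi : R -> R) :
  convex_function (`[0, eps[)%classic (fun s => - phi s) ->
  (forall s, 0 < s < eps -> derivable phi s 1) ->
  forall s t, 0 < s < eps -> 0 <= t < eps ->
  derive1 phi s * (s - t) <= phi s - phi t.
Proof.
move=> phi_cvx phi_der s t s_in t_in.
have ds : is_derive s 1 phi (derive1 phi s).
  by rewrite derive1E; apply: derivableP; exact: phi_der.
pose q (l : R) := l^-1 *: (phi (s + l * (t - s)) - phi s).
have cv : q l @[l --> (0 : R)^'+] --> derive1 phi s * (t - s).
  have : is_derive (0 : R) 1 (phi \o (fun l : R => s + l * (t - s)))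
      (derive1 phi s * (t - s)).
    apply: is_derive1_comp; first by rewrite mul0r addr0.
    by apply: is_derive_eq; rewrite /GRing.scale/= mulr0 add0r mulr1 add0r mul1r.
  move=> [dq <-]; apply: cvg_dnbhs_at_right.
  have qE : (fun h : R => h^-1 *:
      (((phi \o (fun l : R => s + l * (t - s))) \o shift 0) (h *: 1) -
      (phi \o (fun l : R => s + l * (t - s))) 0)) = q.
    by apply/funext => h; rewrite /q/= addr0 -[h%:A]/(h * 1) mulr1 mul0r addr0.
  by move: dq; rewrite /derivable /derive qE.
rewrite -lerN2 -mulrN !opprB; apply: (cvgr_to_ge cv).
near=> l.
have l0 : 0 < l by near: l; exact: nbhs_right_gt.
have l1 : l <= 1 by near: l; exact: nbhs_right_le.
have := @phi_cvx (Itv01 (ltW l0) l1) t s.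
rewrite !inE/= !in_itv/= => /(_ t_in).
have [/andP[s0 s_eps] /andP[t0 t_eps]] := (s_in, t_in).
move=> /(_ (introT andP (conj (ltW s0) s_eps))).
rewrite /q /GRing.scale/= ler_pdivlMl// => h.
have {h} : - phi (l * t + (1 - l) * s) <= l * (- phi t) + (1 - l) * (- phi s) := h.
have -> : l * t + (1 - l) * s = s + l * (t - s) by ring.
by lra.
Unshelve. all: by end_near. Qed.

(** The roles to have in mind: [r] the values of the objective above its limit,
    [D] the step lengths, [G] the gradient norms. The bound [G_le] on a gradient
    by the preceding step is the relative error condition of descent methods. *)
Section KLSequence.
Context {R : realType} {V : normedModType R}.
Variables (x : nat -> V) (xb : V) (r D G : nat -> R) (a b : R).
Variables (eps : R) (U : set V) (phi : R -> R).
Hypotheses (a_gt0 : 0 < a) (b_gt0 : 0 < b) (D_ge0 : forall k, 0 <= D k).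
Hypothesis x_step : forall k, `|x k.+1 - x k| <= D k.
Hypothesis r_decr : forall k, a * D k ^+ 2 <= r k - r k.+1.
Hypothesis G_le : forall k, G k.+1 <= b * D k.
Hypothesis r_cvg0 : r @ \oo --> 0.
Hypothesis x_cluster : cluster (x @ \oo) xb.
Hypotheses (eps_gt0 : 0 < eps) (xbU : nbhs xb U) (phi_des : desingularizing eps phi).
Hypothesis KL : forall k, U (x k) -> 0 < r k < eps ->
  1 <= derive1 phi (r k) * G k.

Lemma values_nincr k : r k.+1 <= r k.
Proof.
rewrite -subr_ge0; apply: le_trans (r_decr k).
by rewrite mulr_ge0 ?sqr_ge0// ltW.
Qed.

Lemma values_ge0 k : 0 <= r k.
Proof.
rewrite -(cvg_lim _ r_cvg0)//; apply: nonincreasing_cvgn_ge.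
  by apply/nonincreasing_seqP; exact: values_nincr.
by apply/cvg_ex; exists 0.
Qed.

Lemma steps_cvg0 : D @ \oo --> 0.
Proof.
apply/cvgr0Pnorm_lt => e e0; near=> k.
rewrite ger0_norm// -(@ltr_pXn2r _ 2)// ?nnegrE ?(ltW e0)//.
rewrite -(ltr_pM2l a_gt0); apply: (le_lt_trans (r_decr k)).
have rk : r k < a * e ^+ 2.
  by near: k; apply: cvgr_lt r_cvg0 _ _; rewrite mulr_gt0// exprn_gt0.
by have := values_ge0 k.+1; lra.
Unshelve. all: by end_near. Qed.

Lemma phi_values_cvg0 : phi (r k) @[k --> \oo] --> 0.
Proof.
have [[phi_cont _ _ _] [_ phi0 _]] := phi_des.
have eps0 : `[0, eps[%classic (0 : R) by rewrite /= in_itv/= lexx.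
have phi_cvg : phi @ within `[0, eps[ (nbhs (0 : R)) --> (0 : R).
  rewrite (nbhs_subspace_in eps0) -[X in _ --> X]phi0.
  exact: phi_cont.
apply: cvg_comp phi_cvg => P /= P0.
have reps : \forall k \near \oo, r k < eps by exact: cvgr_lt r_cvg0 _ eps_gt0.
have := r_cvg0 P0; apply: filterS2 reps => k rk; apply.
by rewrite /= in_itv/= values_ge0.
Qed.

(** One step of the KL argument: the tangent inequality of the concave [phi]
    turns the decrease of [r] into a bound on [D k.+1 ^+ 2 / D k], and
    [2 * Num.sqrt (u * v) <= u + v] makes it telescope. When [r k.+1 = 0] the
    sequence has stopped and the inequality is trivial. *)
Lemma KL_step k : U (x k.+1) -> r k.+1 < eps ->
  2 * D k.+1 <= D k + b / a * (phi (r k.+1) - phi (r k.+2)).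
Proof.
move=> xU reps.
have [[_ phi_cvx phi_der _] [_ _ phi'_gt0]] := phi_des.
have := values_ge0 k.+1; rewrite le_eqVlt => /predU1P[r0|r0].
  have r20 : r k.+2 = 0.
    by apply/eqP; rewrite eq_le values_ge0 andbT r0 values_nincr.
  have D0 : D k.+1 = 0.
    have := r_decr k.+1; rewrite -r0 r20 subrr pmulr_rle0// => D2.
    by apply/eqP; rewrite -sqrf_eq0 eq_le D2 sqr_ge0.
  by rewrite D0 -r0 r20 subrr !mulr0 addr0.
have r_in : 0 < r k.+1 < eps by rewrite r0.
have r2_in : 0 <= r k.+2 < eps by rewrite values_ge0 (le_lt_trans (values_nincr _)).
have tangent := concave_tangent phi_cvx phi_der r_in r2_in.
have dphi := phi'_gt0 _ r_in.
set d := derive1 phi (r k.+1) in tangent dphi.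
have KLk : 1 <= d * (b * D k).
  by apply: (le_trans (KL xU r_in)); rewrite ler_wpM2l ?G_le// ltW.
set P := phi (r k.+1) - phi (r k.+2) in tangent *.
have dP : d * (a * D k.+1 ^+ 2) <= P.
  by apply: le_trans tangent; rewrite ler_wpM2l ?r_decr// ltW.
have P0 : 0 <= P by apply: le_trans dP; rewrite !mulr_ge0 ?sqr_ge0// ltW.
have key : D k.+1 ^+ 2 <= D k * (b / a * P).
  have : a * D k.+1 ^+ 2 * 1 <= a * D k.+1 ^+ 2 * (d * (b * D k)).
    by rewrite ler_wpM2l// mulr_ge0 ?sqr_ge0// ltW.
  have : b * D k * (d * (a * D k.+1 ^+ 2)) <= b * D k * P.
    by rewrite ler_wpM2l// mulr_ge0// ltW.
  move=> h1 h2; rewrite -(ler_pM2l a_gt0).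
  have -> : a * (D k * (b / a * P)) = b * D k * P.
    by field; rewrite gt_eqF.
  by lra.
have bP : 0 <= b / a * P by rewrite mulr_ge0// divr_ge0// ltW.
rewrite -(@ler_pXn2r _ 2)// ?nnegrE ?mulr_ge0 ?addr_ge0//.
have := sqr_ge0 (D k - b / a * P); move: key.
set y := b / a * P; move=> key; rewrite !expr2 in key *; lra.
Qed.

(** As long as the iterates stay in [U] the steps telescope; they are then too
    short for the iterates to leave [U], once one iterate is close to [xb] and
    the remaining budget [D N + b / a * phi (r N.+1)] is small. *)
Lemma KL_trap (rho : R) : 0 < rho -> exists N, forall m,
  \sum_(i < m) D (N.+1 + i)%N <= rho /\ `|x (N.+1 + m)%N - xb| < rho.
Proof.
move=> rho0; have [_ [phi_ge0 _ _]] := phi_des.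
have [rU /= rU0 ballU] := (nbhs_ballP _ _).1 xbU.
(* half of the radius is for the distance of one iterate to [xb], half for
   the path that follows it *)
pose e := Num.min rho rU / 2.
have e0 : 0 < e by rewrite divr_gt0// lt_min rho0.
have erho : 2 * e <= rho by rewrite /e mulrC divfK// ge_min lexx.
have erU : 2 * e <= rU by rewrite /e mulrC divfK// ge_min lexx orbT.
have budget : \forall k \near \oo, D k + b / a * phi (r k.+1) <= e.
  have : (D k + b / a * phi (r k.+1)) @[k --> \oo] --> 0 + b / a * (0 : R).
    apply: cvgD steps_cvg0 _; apply: cvgMl_tmp.
    by have := phi_values_cvg0; rewrite -cvg_shiftS.
  by rewrite mulr0 addr0 => h; exact: cvgr_le h _ e0.
have reps : \forall k \near \oo, r k < eps by exact: cvgr_lt r_cvg0 _ eps_gt0.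
have [N1 _ N1P] := filterI budget reps.
have [N [NN1 xN]] : exists N, (N1 <= N)%N /\ `|x N.+1 - xb| < e.
  have [] := x_cluster (A := [set x k | k in [set k | (N1 < k)%N]]) _
    (nbhsx_ballx xb _ e0).
    by exists N1.+1 => // k /= N1k; exists k.
  move=> _ [[[//|k] /= N1k <-]]; rewrite -ball_normE/= distrC => xke.
  by exists k.
exists N => m.
have [budgetN _] := N1P _ NN1.
have rlt k : (N1 <= k)%N -> r k < eps by move=> /N1P[].
have rin k : (N1 <= k)%N -> 0 <= r k < eps by move=> kN; rewrite values_ge0 rlt.
have xsum j : `|x (N.+1 + j)%N - xb| <=
    `|x N.+1 - xb| + \sum_(i < j) D (N.+1 + i)%N.
  elim: j => [|j IH]; first by rewrite addn0 big_ord0 addr0.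
  rewrite big_ord_recr/= addnS.
  have := ler_normD (x (N.+1 + j).+1 - x (N.+1 + j)%N) (x (N.+1 + j)%N - xb).
  rewrite addrA subrK.
  by have := x_step (N.+1 + j); lra.
have main j : \sum_(i < j) D (N.+1 + i)%N <=
    D N - D (N + j)%N + b / a * (phi (r N.+1) - phi (r (N.+1 + j)%N)).
  elim: j => [|j IH]; first by rewrite !addn0 big_ord0 !subrr mulr0 addr0.
  have leN k : (N1 <= N.+1 + k)%N by rewrite (leq_trans NN1)// addSn leqW// leq_addr.
  have phik : 0 <= b / a * phi (r (N.+1 + j)%N).
    by rewrite mulr_ge0 ?divr_ge0 ?phi_ge0 ?rin// ltW.
  have sumj : \sum_(i < j) D (N.+1 + i)%N <= e.
    by have := D_ge0 (N + j); lra.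
  have : U (x (N.+1 + j)%N).
    apply: ballU; rewrite -ball_normE/= distrC.
    by have := xsum j; lra.
  rewrite big_ord_recr/= addSn => /KL_step/(_ (rlt _ (leN j))).
  by rewrite !addnS !addSn in IH *; lra.
have phim : 0 <= b / a * phi (r (N.+1 + m)%N).
  rewrite mulr_ge0 ?divr_ge0 ?phi_ge0 ?rin ?(ltW a_gt0) ?(ltW b_gt0)//.
  by rewrite (leq_trans NN1)// addSn leqW// leq_addr.
have := D_ge0 (N + m); have := main m; have := xsum m; move=> *.
by split; lra.
Qed.

Lemma KL_cvg : x @ \oo --> xb.
Proof.
apply/cvgrPdist_lt => e /KL_trap[N xN]; exists N.+1 => // k /= Nk.
by rewrite distrC -(subnKC Nk); case: (xN (k - N.+1)%N).
Qed.

Lemma KL_finite_length : exists B, forall m, \sum_(i < m) D i <= B.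
Proof.
have [N xN] := KL_trap ltr01.
exists (\sum_(i < N.+1) D i + 1) => m.
apply: (@le_trans _ _ (\sum_(i < N.+1 + m) D i)).
  by rewrite addnC big_split_ord/= lerDl sumr_ge0.
by rewrite big_split_ord/= lerD2l; case: (xN m).
Qed.

End KLSequence.

(** * Convergence rates of the values *)

Section Rates.
Context {R : realType}.
Variables (s : nat -> R) (alpha theta : R).
Hypotheses (s_ge0 : forall k, 0 <= s k) (s_nincr : forall k, s k.+1 <= s k).
Hypotheses (s_cvg0 : s @ \oo --> 0) (alpha_gt0 : 0 < alpha).
Hypothesis s_decr : \forall k \near \oo,
  0 < s k.+1 -> alpha * s k.+1 `^ (2 * theta) <= s k - s k.+1.

Lemma near_values_lt (e : R) : 0 < e -> \forall k \near \oo, s k < e.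
Proof. by move=> e0; apply: cvgr_lt s_cvg0 _ e0. Qed.

Lemma near_valuesS_lt (e : R) : 0 < e -> \forall k \near \oo, s k.+1 < e.
Proof. by move=> /near_values_lt; apply: filterS => k; exact: le_lt_trans. Qed.

(** A late step ending above the limit value would decrease [s] by at least
    [alpha], although [s] is already below [alpha]. *)
Lemma rate_finite : theta = 0 -> \forall k \near \oo, s k = 0.
Proof.
move=> theta0.
suff : \forall k \near \oo, s k.+1 = 0.
  move=> [N _ sN]; exists N.+1 => // -[//|k] /= Nk; exact: sN.
near=> k; apply/eqP/negPn; rewrite neq_lt; apply/orP => -[|sk].
  by rewrite ltNge s_ge0.
have : 0 < s k.+1 -> alpha * s k.+1 `^ (2 * theta) <= s k - s k.+1.
  by near: k.
rewrite theta0 mulr0 powRr0 mulr1 => /(_ sk).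
have : s k < alpha by near: k; exact: near_values_lt.
by lra.
Unshelve. all: by end_near. Qed.

(** Small values satisfy [s k.+1 <= s k.+1 `^ (2 * theta)], so the decrease is at
    least [alpha * s k.+1]. *)
Lemma rate_linear : 0 < theta <= 2^-1 ->
  exists q, 0 < q < 1 /\ \forall k \near \oo, s k.+1 <= q * s k.
Proof.
move=> /andP[theta0 theta2]; exists (1 + alpha)^-1; split.
  by rewrite invr_gt0 invf_lt1 addr_gt0// ltrDl.
near=> k; rewrite ler_pdivlMl ?addr_gt0//.
have := s_ge0 k.+1; rewrite le_eqVlt => /predU1P[<-|sk]; first by rewrite mulr0.
have : 0 < s k.+1 -> alpha * s k.+1 `^ (2 * theta) <= s k - s k.+1.
  by near: k.
move=> /(_ sk) sdec.
have : s k.+1 <= s k.+1 `^ (2 * theta).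
  apply: ger1_powR; last by lra.
  by rewrite sk ltW//; near: k; exact: near_valuesS_lt.
by move=> /(ler_wpM2l (ltW alpha_gt0)); lra.
Unshelve. all: by end_near. Qed.

(** From [ln (1 + t) >= t / (1 + t)] and [expR y >= 1 + y]. *)
Lemma powR1D_ge (p t : R) : 0 <= p -> 0 <= t <= 1 -> 1 + p * (t / 2) <= (1 + t) `^ p.
Proof.
move=> p0 /andP[t0 t1]; have t10 : 0 < 1 + t by lra.
rewrite /powR gt_eqF//; apply: (le_trans _ (expR_ge1Dx _)).
rewrite lerD2l ler_wpM2l// -lerN2 -lnV//.
have -> : (1 + t)^-1 = 1 + - (t / (1 + t)) by field; rewrite gt_eqF.
apply: (le_trans (le_ln1Dx _)).
  by rewrite ltrN2 ltr_pdivrMr// mul1r; lra.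
by rewrite lerN2 ler_wpM2l// lef_pV2 ?posrE//; lra.
Qed.

(** With [v k := s k `^ p], [p := 2 * theta - 1], the decrease of [s] becomes
    [v k.+1 * (1 + c * v k.+1) <= v k], the discrete form of [v' = - c * v ^ 2],
    whence [v k = O(1 / k)]. *)
Lemma rate_sublinear : 2^-1 < theta < 1 ->
  s =O_\oo (fun k : nat => k%:R `^ (- (2 * theta - 1)^-1)).
Proof.
move=> /andP[theta2 theta1]; pose p := 2 * theta - 1.
have p0 : 0 < p by rewrite /p; lra.
pose v k := s k `^ p; pose c := p * alpha / 2.
have c0 : 0 < c by rewrite /c divr_gt0// mulr_gt0.
have v_ge0 k : 0 <= v k by exact: powR_ge0.
have v_decr : \forall k \near \oo, v k.+1 <= 1 /\ v k.+1 * (1 + c * v k.+1) <= v k.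
  near=> k.
  have [sk0|sk0] := eqVneq (s k.+1) 0.
    by rewrite {1 2}/v sk0 powR0 ?gt_eqF// ler01 mul0r.
  have {}sk0 : 0 < s k.+1 by rewrite lt_neqAle eq_sym sk0 s_ge0.
  have vk0 : 0 < v k.+1 by rewrite powR_gt0.
  have v_small e : 0 < e -> s k.+1 <= e `^ p^-1 -> v k.+1 <= e.
    move=> e0 sle; have : (s k.+1) `^ p <= (e `^ p^-1) `^ p.
      by apply: ge0_ler_powR => //; rewrite ?nnegrE ?powR_ge0 ?ltW.
    by rewrite -powRrM mulVf ?gt_eqF// (powRr1 (ltW e0)).
  split.
    apply: v_small => //; apply: ltW; near: k.
    by apply: near_valuesS_lt; exact: powR_gt0.
  pose t := alpha * v k.+1.
  have t01 : 0 <= t <= 1.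
    apply/andP; split; first by rewrite mulr_ge0// ltW.
    rewrite /t -ler_pdivlMl// mulr1.
    apply: v_small; first by rewrite invr_gt0.
    by apply: ltW; near: k; apply: near_valuesS_lt; rewrite powR_gt0// invr_gt0.
  have : 0 < s k.+1 -> alpha * s k.+1 `^ (2 * theta) <= s k - s k.+1.
    by near: k.
  move=> /(_ sk0).
  have -> : 2 * theta = 1 + p by rewrite /p; lra.
  rewrite powRD; last by rewrite (gt_eqF sk0) implybT.
  rewrite (powRr1 (ltW sk0)) -/(v _) => sk.
  have : s k.+1 * (1 + t) <= s k by rewrite /t; lra.
  have [t0 t1] := andP t01; have t10 : 0 <= 1 + t by lra.
  move=> sle; have : (s k.+1 * (1 + t)) `^ p <= s k `^ p.
    by apply: ge0_ler_powR; rewrite ?nnegrE ?mulr_ge0// ltW.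
  rewrite powRM ?s_ge0//.
  apply: le_trans; rewrite -/(v _) ler_wpM2l//.
  apply: le_trans (powR1D_ge (ltW p0) t01).
  by rewrite lerD2l /c /t; lra.
have [N _ vN] := v_decr.
(* [mu] is chosen so that [mu * (1 + c * A) <= c] whenever [A <= 1], which is
   what the induction step needs *)
pose mu := c / (1 + c).
have c10 : 0 < 1 + c by lra.
have mu0 : 0 < mu by exact: divr_gt0.
have muc : mu * (1 + c) = c by rewrite divfK// gt_eqF.
have v_le m : m%:R * mu * v (N + m)%N <= 1.
  elim: m => [|m IH]; first by rewrite !mul0r.
  rewrite addnS; have [v1 vd] := vN (N + m)%N (leq_addr _ _).
  set A := v (N + m).+1 in v1 vd *.
  have A0 : 0 <= A by exact: v_ge0.
  have cA : 0 < 1 + c * A by rewrite ltr_pwDl// mulr_ge0// ltW.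
  rewrite -(ler_pM2r cA) mul1r -[m.+1]addn1 natrD.
  have : m%:R * mu * (A * (1 + c * A)) <= 1.
    by apply: le_trans IH; rewrite ler_wpM2l// mulr_ge0// ltW.
  have : mu * (1 + c * A) <= c.
    by rewrite -[leRHS]muc (ler_wpM2l (ltW mu0))// lerD2l (ler_piMr (ltW c0)).
  move=> /(ler_wpM2r A0); lra.
apply/eqO_exP; exists ((mu / 2) `^ (- p^-1)); first by rewrite powR_gt0// divr_gt0.
near=> k.
have k2N : (2 * N < k)%N by near: k; exact: nbhs_infty_gt.
have k0 : 0 < k%:R :> R by rewrite ltr0n (leq_ltn_trans _ k2N).
have mu20 : 0 < mu / 2 by rewrite divr_gt0.
rewrite !ger0_norm ?powR_ge0// -powRM ?(ltW mu20) ?(ltW k0)//.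
have -> : s k = v k `^ p^-1.
  by rewrite -powRrM mulfV ?gt_eqF// powRr1.
have muk0 : 0 < mu / 2 * k%:R by exact: mulr_gt0.
rewrite -mulN1r powRrM (powR_inv1 (ltW muk0)).
apply: ge0_ler_powR; rewrite ?nnegrE ?invr_ge0 ?(ltW muk0) ?(ltW p0)//.
rewrite -[leRHS]mul1r ler_pdivlMr//.
have := v_le (k - N)%N; rewrite subnKC; last by lia.
apply: le_trans; rewrite mulrC ler_wpM2r//.
rewrite natrB; last by lia.
have : (2 * N)%:R <= k%:R :> R by rewrite ler_nat ltnW.
rewrite natrM => kN.
have : mu * (k%:R - 2%:R * N%:R) >= 0 by rewrite (mulr_ge0 (ltW mu0))// subr_ge0.
lra.
Unshelve. all: by end_near. Qed.

End Rates.

(** * One Bregman proximal step *)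

Section ProximalStep.
Context {R : realType} {n : nat}.
Variables (X : set 'rV[R]_n) (h f : 'rV[R]_n -> R) (hX : 'rV[R]_n -> \bar R).
Hypotheses (hC1 : C1 X h) (fC1 : C1 X f) (hX_ext : continuous_extension X h hX).

Definition prox_obj (eta : R) (x z : 'rV[R]_n) : R :=
  f z + eta^-1 * (h z - h x - dot (rgrad X h x) (z - x)).

Lemma prox_objE eta x z : ri X z ->
  ((f z)%:E + (eta^-1)%:E * bregman X h hX z x)%E = (prox_obj eta x z)%:E.
Proof. by move=> zX; rewrite /bregman (hX_ext.1 _ zX) -!EFinB -EFinM -EFinD. Qed.

Variables (eta : R) (x y : 'rV[R]_n).
Hypotheses (eta_gt0 : 0 < eta) (xX : ri X x) (yX : ri X y).
Hypothesis y_min : global_min X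
  (fun z => (f z)%:E + (eta^-1)%:E * bregman X h hX z x)%E y.

Lemma prox_min z : ri X z -> prox_obj eta x y <= prox_obj eta x z.
Proof.
by move=> zX; rewrite -lee_fin -!prox_objE//; apply: y_min.2; case: zX.
Qed.

(** The Bregman term vanishes at the previous iterate, which competes in the
    minimization. *)
Lemma prox_decrease : eta^-1 * (h y - h x - dot (rgrad X h x) (y - x)) <= f x - f y.
Proof.
have := prox_min xX; rewrite /prox_obj !subrr dot0r subrr mulr0 addr0; lra.
Qed.

(** First-order optimality of the new iterate, which lies in the relative
    interior. *)
Lemma prox_rgrad : rgrad X f y = eta^-1 *: (rgrad X h x - rgrad X h y).
Proof.
have [df _] := rgradP fC1 yX; have [dhy _] := rgradP hC1 yX.
have [dhx _] := rgradP hC1 xX.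
pose d := rgrad X f y - eta^-1 *: (rgrad X h x - rgrad X h y).
suff : d = 0 by move=> /eqP; rewrite subr_eq0 => /eqP.
apply: (rgrad_min_eq0 (g := prox_obj eta x) yX); last exact: prox_min.
split; first by apply: dirB => //; apply: dirZ; exact: dirB.
apply/eqoP => e e0.
have e20 : 0 < e / 2 by rewrite divr_gt0.
have := is_rgrad_near (rgradP hC1 yX) (mulr_gt0 e20 eta_gt0).
apply: filterS2 (is_rgrad_near (rgradP fC1 yX) e20) => z /= fz hz.
rewrite /prox_obj /d dotBl dotZl dotBl.
set F := f z - f y - _ in fz; set H := h z - h y - _ in hz.
have -> : dot (rgrad X h x) (z - x) =
    dot (rgrad X h x) (z - y) + dot (rgrad X h x) (y - x).
  by rewrite ![dot (rgrad X h x) _]dotC -dotDl addrA subrK.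
rewrite [X in `|X|](_ : _ = F + eta^-1 * H); last by rewrite /F /H; ring.
apply: (le_trans (ler_normD _ _)).
rewrite normrM gtr0_norm ?invr_gt0//.
have : eta^-1 * `|H| <= e / 2 * `|z - y|.
  by rewrite ler_pdivrMl// mulrA (mulrC eta).
lra.
Qed.

End ProximalStep.

(** * Convergence of the Bregman proximal method *)

Theorem theorem7p8 (R : realType) (n : nat) (X : set 'rV[R]_n)
    (h f : 'rV[R]_n -> R) (hX : 'rV[R]_n -> \bar R)
    (x : nat -> 'rV[R]_n) (eta : nat -> R) (eta_lo eta_hi : R)
    (K : set 'rV[R]_n) (sigma L : R)
    (X_neq0 : X !=set0) (X_closed : closed X) (X_convex : convex_set X)
    (h_legendre : legendre X h) (hX_ext : continuous_extension X h hX)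
    (f_C1 : C1 X f)
    (x0_ri : ri X (x 0%N))
    (eta_lo_gt0 : 0 < eta_lo)
    (eta_bounds : forall k, eta_lo <= eta k <= eta_hi)
    (x_step : forall k, ri X (x k.+1) /\
      global_min X
        (fun y => (f y)%:E + ((eta k)^-1)%:E * bregman X h hX y (x k))%E
        (x k.+1))
    (K_compact : compact K) (K_convex : convex_set K) (K_ri : K `<=` ri X)
    (x_K : forall k, K (x k))
    (sigma_L : 0 < sigma <= L)
    (hess_K : forall z, K z -> rhess_bounds X h z sigma L)
    (f_bounded_below : exists m : R, forall z, K z -> m <= f z)
    (f_KL : forall z, K z -> KL_at X f z) :
  (\sum_(0 <= k <oo) (enorm (x k.+1 - x k))%:E < +oo)%E /\
  exists xs : 'rV[R]_n,
    [/\ K xs, x @ \oo --> xs, is_rgrad X f xs 0 &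
      forall theta : R, 0 <= theta < 1 -> KL_exponent X f xs theta ->
      let s := fun k : nat => f (x k) - f xs in
      [/\ theta = 0 ->
            exists N : nat, forall k, (N <= k)%N -> s k = 0 /\ x k = xs,
          0 < theta <= 2^-1 ->
            exists q : R, 0 < q < 1 /\ \forall k \near \oo, s k.+1 <= q * s k
        & 2^-1 < theta < 1 ->
            s =O_\oo (fun k : nat => k%:R `^ (- (2 * theta - 1)^-1)) ] ].
Proof.
have [hC2 _ _] := h_legendre; have [hC1 _ _] := hC2.
have eta_gt0 k : 0 < eta k.
  by have /andP[+ _] := eta_bounds k; exact: lt_le_trans.
have eta_hi_gt0 : 0 < eta_hi.
  by have /andP[_] := eta_bounds 0%N; exact: lt_le_trans.
have x_ri k : ri X (x k) by exact/K_ri/x_K.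
pose D k := enorm (x k.+1 - x k).
have D_ge0 k : 0 <= D k by exact: enorm_ge0.
have [sigma_gt0 _] := andP sigma_L.
pose a := eta_hi^-1 * (sigma / 2).
have a_gt0 : 0 < a by rewrite mulr_gt0 ?invr_gt0 ?divr_gt0.
have decr k : a * D k ^+ 2 <= f (x k) - f (x k.+1).
  apply: le_trans (prox_decrease hX_ext (x_ri k) (x_ri k.+1) (x_step k).2).
  have hess_ge z : K z -> forall v, dir X v ->
      sigma * dot v v <= dot (v *m rhess X h z) v.
    by move=> Kz v dv; have /andP[] := hess_K _ Kz _ dv.
  have breg := bregman_ge_sqr hC2 K_convex K_ri hess_ge (x_K k) (x_K k.+1).
  rewrite /a -mulrA sqr_enorm; apply: ler_pM => //.
  - by rewrite invr_ge0 ltW.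
  - by rewrite mulr_ge0 ?dot_ge0// divr_ge0// ltW.
  - by rewrite lef_pV2 ?posrE//; have /andP[] := eta_bounds k.
have [C C_gt0 lipC] := rgrad_lipschitz hC2 K_compact K_convex K_ri.
(* the factor [n] converts the sup norm into the Euclidean norm, and the
   summand 1 keeps [b] positive when [n = 0] *)
pose b := 1 + n%:R * (eta_lo^-1 * C).
have b_gt0 : 0 < b by rewrite ltr_pwDl// mulr_ge0// ltW// mulr_gt0// invr_gt0.
pose G k := enorm (rgrad X f (x k)).
have G_le k : G k.+1 <= b * D k.
  apply: (@le_trans _ _ (n%:R * (eta_lo^-1 * C) * D k)); last first.
    by rewrite ler_wpM2r// lerDr.
  rewrite -mulrA; apply: (le_trans (enorm_le_normr _)); rewrite ler_wpM2l//.
  rewrite (prox_rgrad hC1 f_C1 hX_ext (eta_gt0 k) (x_ri k) (x_ri k.+1) (x_step k).2).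
  rewrite normrZ gtr0_norm ?invr_gt0// -mulrA; apply: ler_pM => //.
  - by rewrite invr_ge0 ltW.
  - by rewrite lef_pV2 ?posrE//; have /andP[] := eta_bounds k.
  - rewrite distrC; apply: (le_trans (lipC _ _ (x_K k) (x_K k.+1))).
    by rewrite ler_wpM2l ?normr_le_enorm// ltW.
have [xs [Kxs xs_cluster]] : K `&` cluster (x @ \oo) !=set0.
  by apply: K_compact; exists 0%N => // k _; exact: x_K.
have xs_ri := K_ri _ Kxs.
have f_xs := is_rgrad_continuous (rgradP f_C1 xs_ri).
pose r k := f (x k) - f xs.
have r_decr k : a * D k ^+ 2 <= r k - r k.+1.
  by rewrite /r opprB addrA subrK; exact: decr.
have r_cvg0 : r @ \oo --> 0.
  have fx_cvg : cvgn (f \o x).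
    apply: nonincreasing_is_cvgn.
      apply/nonincreasing_seqP => k /=; rewrite -subr_ge0.
      by apply: le_trans (decr k); rewrite mulr_ge0 ?sqr_ge0// ltW.
    by have [m mf] := f_bounded_below; exists m => _ [k _ <-]; exact: mf.
  suff fx_lim : limn (f \o x) = f xs.
    by rewrite -(subrr (f xs)) -{1}fx_lim; apply: cvgB => //; exact: cvg_cst.
  (* some late iterate has its value close both to the limit and to [f xs] *)
  apply/eqP; rewrite -subr_eq0 -normr_le0.
  apply/ler_addgt0Pr => e e_gt0; rewrite add0r.
  have e2_gt0 : 0 < e / 2 by rewrite divr_gt0.
  have near_lim : \forall k \near \oo, `|limn (f \o x) - (f \o x) k| <= e / 2.
    by apply: cvgr_dist_le; [exact: fx_cvg|exact: e2_gt0].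
  have near_fxs : \forall z \near anbhs X xs, `|f xs - f z| <= e / 2.
    by apply: cvgr_dist_le; [exact: f_xs|exact: e2_gt0].
  have [|_ [[k xk_lim <-] xk_fxs]] :=
    xs_cluster (x @` [set k | `|limn (f \o x) - (f \o x) k| <= e / 2]) _ _ near_fxs.
    by apply: filterS near_lim => k ?; exists k.
  have {}xk_fxs := xk_fxs (ri_aff (x_ri k)).
  have := ler_distD (f (x k)) (limn (f \o x)) (f xs).
  by rewrite (distrC (f (x k))); move: xk_lim => /=; lra.
have [eps [U [phi [eps_gt0 U_xs phi_des KL]]]] := f_KL _ Kxs.
have KLr k : U (x k) -> 0 < r k < eps -> 1 <= derive1 phi (r k) * G k.
  move=> xU /andP[]; rewrite /r => rk0 rke.
  by apply: KL => //; apply/andP; split; lra.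
have x_D k : `|x k.+1 - x k| <= D k by exact: normr_le_enorm.
have x_cvg := KL_cvg a_gt0 b_gt0 D_ge0 x_D r_decr G_le r_cvg0 xs_cluster eps_gt0
  U_xs phi_des KLr.
have [B sumD] := KL_finite_length a_gt0 b_gt0 D_ge0 x_D r_decr G_le r_cvg0
  xs_cluster eps_gt0 U_xs phi_des KLr.
have r_ge0 := values_ge0 a_gt0 r_decr r_cvg0.
have r_nincr := values_nincr a_gt0 r_decr.
split.
  apply: (@le_lt_trans _ _ B%:E); last exact: ltry.
  apply: lime_le.
    by apply: is_cvg_nneseries => k _ _; rewrite lee_fin enorm_ge0.
  by apply: nearW => m; rewrite sumEFin lee_fin big_mkord.
have crit : rgrad X f xs = 0.
  have gcont : rgrad X f @ within (ri X) (nbhs xs) --> rgrad X f xs.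
    by rewrite (nbhs_subspace_in xs_ri); exact: f_C1.2.
  have gx_cvg : rgrad X f (x k) @[k --> \oo] --> rgrad X f xs.
    have x_within : x @ \oo --> within (ri X) (nbhs xs).
      move=> P /= /x_cvg near_P.
      have {}near_P : \forall k \near \oo, ri X (x k) -> P (x k) := near_P.
      by apply: filterS near_P => k; apply.
    exact: cvg_comp x_within gcont.
  apply: (cvg_unique _ gx_cvg) => //=.
  rewrite -(cvg_shiftS (fun k => rgrad X f (x k))).
  apply: norm_cvg0; apply: (@squeeze_cvgr _ _ _ _ (fun=> 0) (fun k => b * D k)).
  - apply: nearW => k; rewrite normr_ge0/=.
    by apply: le_trans (G_le k); exact: normr_le_enorm.
  - exact: cvg_cst.
  - by rewrite -(mulr0 b); apply: cvgMl_tmp; exact: steps_cvg0 r_decr r_cvg0.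
exists xs; split => //.
  by rewrite -crit; exact: rgradP.
move=> theta theta01 [c [eps' [U' [c_gt0 [eps'_gt0 U'_xs _ KL']]]]] s.
pose alpha := a / (c * (1 - theta) * b) ^+ 2.
have [theta_ge0 theta_lt1] := andP theta01.
have cb_gt0 : 0 < c * (1 - theta) * b by rewrite !mulr_gt0// subr_gt0.
have alpha_gt0 : 0 < alpha by rewrite divr_gt0// exprn_gt0.
have s_decr : \forall k \near \oo,
    0 < s k.+1 -> alpha * s k.+1 `^ (2 * theta) <= s k - s k.+1.
  have near_U' : \forall k \near \oo, U' (x k.+1).
    by have := x_cvg; rewrite -cvg_shiftS; apply.
  have near_eps' : \forall k \near \oo, s k.+1 < eps'.
    by have := r_cvg0; rewrite -cvg_shiftS => rS; exact: cvgr_lt rS _ eps'_gt0.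
  apply: filterS2 near_U' near_eps' => k xU' sk_eps sk.
  have powS : 0 < s k.+1 `^ theta by exact: powR_gt0.
  have {}KL' : s k.+1 `^ theta <= c * (1 - theta) * b * D k.
    have := KL' _ (x_ri k.+1) xU'.
    rewrite -ltrBlDl -/(s k.+1) -subr_gt0 sk sk_eps => /(_ isT).
    have dpow := is_derive1_powR (1 - theta) sk.
    have dphi : is_derive (s k.+1) 1 (fun t => c * t `^ (1 - theta))
        (c * ((1 - theta) * s k.+1 `^ (- theta))).
      by apply: is_derive_eq; rewrite (_ : 1 - theta - 1 = - theta)//; ring.
    rewrite derive1E derive_val powRN => KLk.
    have : 1 <= c * ((1 - theta) * (s k.+1 `^ theta)^-1) * (b * D k).
      apply: (le_trans KLk); rewrite ler_wpM2l ?G_le//.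
      by rewrite !mulr_ge0 ?invr_ge0// ltW// subr_gt0.
    have -> : c * ((1 - theta) * (s k.+1 `^ theta)^-1) * (b * D k) =
      (c * (1 - theta) * b * D k) / s k.+1 `^ theta by ring.
    by rewrite ler_pdivlMr// mul1r.
  apply: le_trans (r_decr k).
  rewrite /alpha mulrAC ler_pdivrMr ?exprn_gt0// -[leRHS]mulrA.
  rewrite (ler_wpM2l (ltW a_gt0))//.
  rewrite mulrC powRrM powR_mulrn ?powR_ge0// -exprMn (mulrC (D k)).
  by rewrite ler_pXn2r// nnegrE ?powR_ge0// (le_trans _ KL')// powR_ge0.
split.
- move=> theta0.
  have [N _ sN] := rate_finite r_ge0 r_cvg0 alpha_gt0 s_decr theta0.
  have stop k : (N <= k)%N -> x k.+1 = x k.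
    move=> Nk; have rk : r k = 0 := sN _ Nk.
    have rk1 : r k.+1 = 0 := sN _ (leqW Nk).
    have := r_decr k; rewrite rk rk1 subrr pmulr_rle0// => D2.
    apply/eqP; rewrite -subr_eq0; apply/eqP/enorm_eq0/eqP.
    by rewrite -sqrf_eq0 eq_le D2 sqr_ge0.
  exists N => k Nk; split; first exact: sN.
  (* the iterates no longer move after [N], so they are at their limit *)
  have x_const j : x (j + k)%N = x k.
    by elim: j => // j <-; apply: stop; rewrite (leq_trans Nk)// leq_addl.
  apply: (cvg_unique _ _ x_cvg) => //=; rewrite -(cvg_shiftn k x).
  by under eq_fun do rewrite x_const; exact: cvg_cst.
- exact: rate_linear r_ge0 r_nincr r_cvg0 alpha_gt0 s_decr.
- exact: rate_sublinear r_ge0 r_nincr r_cvg0 alpha_gt0 s_decr.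
Qed.
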